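(* Timeline Dominating Set admits a kernel in which both the number of snapshots and the number of vertices are at most cubic in $q+k+\ell$, where $q$ is the maximum number of edges in any snapshot of the input temporal graph; moreover, this kernel can be computed in time linear in the input size. That is, there is a linear-time algorithm that maps every instance $(\mathcal{G},k,\ell)$ to an equivalent instance of Timeline Dominating Set whose number of snapshots and number of vertices are both $\mathcal{O}((q+k+\ell)^3)$.
   Context: A temporal graph $\mathcal{G}=(G_1,\dots,G_T)$ is a finite sequence of simple undirected graphs (snapshots) on a common finite vertex set $V$. A temporal vertex is a pair $(v,i)$. An activity interval is a triple $(v,a,b)$ with $v\in V$, $1\le a\le b\le T$; its length is $b-a$. A $k$-activity $\ell$-timeline is a set of activity intervals with at most $k$ intervals per vertex, each of length at most $\ell$. A vertex $v$ is active at time $i$ if some $(v,a,b)$ in the timeline has $a\le i\le b$; the timeline dominates $(v,i)$ if $v\in N_{G_i}[u]$ for some $u$ active at time $i$. Timeline Dominating Set: given $\mathcal{G}$ and integers $k\ge1,\ell\ge0$, decide whether some $k$-activity $\ell$-timeline dominates all temporal vertices. Two instances are equivalent if both are yes-instances or both are no-instances. *)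

(* Defs.v *)
From mathcomp Require Import all_boot.

Set Implicit Arguments.
Unset Strict Implicit.
Unset Printing Implicit Defensive.

(** * Timeline Dominating Set *)

Record sgraph (V : finType) := SGraph {
  edges : {set {set V}};
  edges_card2 : forall e, e \in edges -> #|e| = 2 }.

Definition closed_nbhd (V : finType) (G : sgraph V) (u : V) : {set V} :=
  [set v | (v == u) || ([set u; v] \in edges G)].

(* Time steps are indexed from 0: the paper's G_1, ..., G_T are
   G 0, ..., G (T - 1). *)
Definition tgraph (V : finType) (T : nat) := 'I_T -> sgraph V.

(* The triple (v, a, b); the condition a <= b is part of [is_timeline]. *)
Definition interval (V : finType) (T : nat) : finType :=
  (V * 'I_T * 'I_T)%type.

Section Timeline.
Variables (V : finType) (T : nat).
Implicit Types (p : interval V T) (S : {set interval V T}) (G : tgraph V T).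

Definition ivertex p : V := p.1.1.
Definition istart p : 'I_T := p.1.2.
Definition iend p : 'I_T := p.2.

Definition is_timeline (k l : nat) S : Prop :=
  (forall p, p \in S -> istart p <= iend p /\ iend p - istart p <= l) /\
  (forall v : V, #|[set p in S | ivertex p == v]| <= k).

Definition active S (v : V) (i : 'I_T) : Prop :=
  exists2 p, p \in S & ivertex p = v /\ istart p <= i <= iend p.

Definition dominates G S (v : V) (i : 'I_T) : Prop :=
  exists2 u, active S u i & v \in closed_nbhd (G i) u.

Definition has_dominating_timeline G (k l : nat) : Prop :=
  exists2 S, is_timeline k l S & forall v i, dominates G S v i.

End Timeline.

Record tds_instance := TDSInstance {
  nverts : nat;
  nsnaps : nat;
  tg : tgraph 'I_nverts nsnaps;
  act : nat;
  len : nat;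
  act_gt0 : 0 < act }.

Definition yes_instance (I : tds_instance) : Prop :=
  has_dominating_timeline (@tg I) (act I) (len I).

Definition max_edges (I : tds_instance) : nat :=
  \max_(i < nsnaps I) #|edges (tg i)|.

Definition parameter (I : tds_instance) : nat :=
  max_edges I + act I + len I.

Definition input_size (I : tds_instance) : nat :=
  nverts I + nsnaps I + \sum_(i < nsnaps I) #|edges (tg i)|.

(** * Encoding of instances as sequences of machine words *)

(* Header |V|, T, k, l; then, snapshot by snapshot, the number of edges
   followed by the edges, each edge listed exactly once as its two endpoints.
   The order of the edges and of the endpoints is arbitrary, so an instance
   has many encodings. *)
Definition encodes (I : tds_instance) (w : seq nat) : Prop :=
  exists2 L : 'I_(nsnaps I) -> seq ('I_(nverts I) * 'I_(nverts I)),
    forall i, perm_eq [seq [set p.1; p.2] | p <- L i] (enum (edges (tg i)))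
  & w = [:: nverts I; nsnaps I; act I; len I] ++
        flatten [seq size (L i) ::
                     flatten [seq [:: nat_of_ord p.1; nat_of_ord p.2]
                             | p <- L i]
                | i <- enum 'I_(nsnaps I)].

(** * Word RAM with a structured control flow *)

(* Registers are named by natural numbers; [Fetch x y] is x := M[y] and
   [Store x y] is M[x] := y. *)
Inductive instr :=
| Const of nat & nat
| Add of nat & nat & nat
| Sub of nat & nat & nat
| Fetch of nat & nat
| Store of nat & nat
| Input of nat
| Output of nat.

Inductive prog :=
| Skip
| Instr of instr
| Seq of prog & prog
| If of nat & prog & prog
| While of nat & prog.

Record state := State {
  regs : nat -> nat;
  mem : nat -> nat;
  inp : seq nat;
  out : seq nat }.

Definition upd (f : nat -> nat) (x v : nat) : nat -> nat :=
  fun y => if y == x then v else f y.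

Definition set_reg (s : state) (x v : nat) : state :=
  State (upd (regs s) x v) (mem s) (inp s) (out s).

(* Words are the numbers at most B: an instruction that would create a larger
   value fails, and so does reading past the end of the input. Subtraction is
   truncated. *)
Definition exec_instr (B : nat) (c : instr) (s : state) : option state :=
  match c with
  | Const x v => if v <= B then Some (set_reg s x v) else None
  | Add x y z =>
      let v := regs s y + regs s z in
      if v <= B then Some (set_reg s x v) else None
  | Sub x y z => Some (set_reg s x (regs s y - regs s z))
  | Fetch x y => Some (set_reg s x (mem s (regs s y)))
  | Store x y =>
      Some (State (regs s) (upd (mem s) (regs s x) (regs s y)) (inp s) (out s))
  | Input x =>
      if inp s is v :: w then
        if v <= B then
          Some (State (upd (regs s) x v) (mem s) w (out s))
        else None
      else None
  | Output x =>
      Some (State (regs s) (mem s) (inp s) (rcons (out s) (regs s x)))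
  end.

(* [exec B P s t s']: started in s, the program P halts in s' after t steps;
   every instruction and every test costs one step. *)
Inductive exec (B : nat) : prog -> state -> nat -> state -> Prop :=
| ExecSkip s : exec B Skip s 1 s
| ExecInstr c s s' : exec_instr B c s = Some s' -> exec B (Instr c) s 1 s'
| ExecSeq P1 P2 s t1 s1 t2 s2 :
    exec B P1 s t1 s1 -> exec B P2 s1 t2 s2 ->
    exec B (Seq P1 P2) s (t1 + t2) s2
| ExecIfTrue x P1 P2 s t s' :
    regs s x != 0 -> exec B P1 s t s' -> exec B (If x P1 P2) s t.+1 s'
| ExecIfFalse x P1 P2 s t s' :
    regs s x = 0 -> exec B P2 s t s' -> exec B (If x P1 P2) s t.+1 s'
| ExecWhileEnd x P s : regs s x = 0 -> exec B (While x P) s 1 s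
| ExecWhileStep x P s t1 s1 t2 s2 :
    regs s x != 0 -> exec B P s t1 s1 -> exec B (While x P) s1 t2 s2 ->
    exec B (While x P) s (t1 + t2).+1 s2.

Definition init_state (w : seq nat) : state :=
  State (fun=> 0) (fun=> 0) w [::].

Definition computes (B : nat) (P : prog) (w : seq nat) (t : nat) (w' : seq nat)
    : Prop :=
  exists2 s, exec B P (init_state w) t s & out s = w'.

(* The largest word is linear in the input size and in the numbers k and l,
   i.e. words have O(log (input_size I + k + l)) bits. *)
Definition word_bound (C : nat) (I : tds_instance) : nat :=
  C * (input_size I + act I + len I + 1).

(* Main.v *)
(** Put c = k (l + 1) and let e_i be the number of edges of snapshot i. If
    T <= c, or if there are no vertices, every vertex can be active all the
    time. Conversely, an inactive dominated vertex is matched to an edge of the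
    snapshot, and some vertex is active, so a dominating timeline has at least
    n - min(n - 1, e_i) active vertices at time i; since each vertex is active
    at most c times, n (T - c) <= s := sum_i min(n - 1, e_i). Hence an instance
    with n (T - c) > s is a no-instance, and one with 0 < n (T - c) <= s is
    already small: s <= (n - 1) T gives T <= n c, and s <= q T gives T <= 2 c
    and n <= q T if n > 2 q. The program thus only computes s and n (T - c) and
    outputs a constant instance or a copy of the input. *)

From mathcomp Require Import all_boot zify.
Require Import Defs.

Set Implicit Arguments.
Unset Strict Implicit.
Unset Printing Implicit Defensive.

(** * Counting active vertices *)

Section Counting.
Variables (V : finType) (T : nat).
Implicit Types (S : {set interval V T}) (G : tgraph V T).

Definition actives S (i : 'I_T) : {set V} :=
  [set v | [exists p in S, (ivertex p == v) && (istart p <= i <= iend p)]].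

Lemma activesP S v i : reflect (active S v i) (v \in actives S i).
Proof.
rewrite inE; apply: (iffP exists_inP) => [[p pS /andP[/eqP pv pi]]|[p pS [pv pi]]];
  exists p => //.
by rewrite pv eqxx.
Qed.

Lemma card_ord_interval a b : #|[set i : 'I_T | a <= i <= b]| <= (b - a).+1.
Proof.
pose f (i : 'I_T) : 'I_(b - a).+1 := inord (i - a).
rewrite -[leqRHS]card_ord -(@card_in_imset _ _ f) ?max_card // => i j.
rewrite !inE => /andP[ai ib] /andP[aj jb] /(congr1 val).
rewrite /f /= !inordK; try lia.
by move=> eq_ij; apply: val_inj => /=; lia.
Qed.

(** Double counting of pairs of an interval and a time it covers: there are at most [#|V| * k]
    intervals, and each covers at most [l.+1] times. *)
Lemma sum_actives_le k l S : is_timeline k l S ->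
  \sum_i #|actives S i| <= #|V| * (k * l.+1).
Proof.
case=> len_S cnt_S.
have cardS : #|S| <= #|V| * k.
  rewrite -sum1_card (partition_big (@ivertex V T) xpredT) //=.
  rewrite -sum_nat_const; apply: leq_sum => v _.
  by rewrite sum1_card; apply: leq_trans (cnt_S v); rewrite cardsE.
(* Only an inequality, since intervals of one vertex may overlap: the active vertices are the image
   under [ivertex] of the intervals covering [i]. *)
have act_le i : #|actives S i| <= \sum_(p in S) (istart p <= i <= iend p).
  rewrite -big_mkcondr sum1_card.
  pose A := [set p in S | istart p <= i <= iend p].
  suff: #|actives S i| <= #|@ivertex V T @: A|.
    by move/leq_trans; apply; apply: leq_trans (leq_imset_card _ _) _; rewrite cardsE.
  apply/subset_leq_card/subsetP => v /activesP[p pS [<- pi]].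
  by apply/imsetP; exists p; rewrite // !inE pS.
apply: (@leq_trans (\sum_(i < T) \sum_(p in S) (istart p <= i <= iend p))).
  by apply: leq_sum => i _.
rewrite exchange_big /= mulnA; apply: leq_trans (leq_mul cardS (leqnn l.+1)).
rewrite -sum_nat_const; apply: leq_sum => p /len_S [_ lp].
rewrite -big_mkcond sum1_card -cardsE.
exact: leq_trans (card_ord_interval _ _) _.
Qed.

(* A dominated inactive vertex picks an edge to an active vertex, and it is the
   only inactive endpoint of that edge. *)
Lemma inactives_le G S i : (forall v, dominates G S v i) ->
  #|~: actives S i| <= #|edges (G i)|.
Proof.
move=> dom.
pose nb v := odflt v [pick u | (u \in actives S i) && ([set u; v] \in edges (G i))].
have nbP v : v \in ~: actives S i ->
    nb v \in actives S i /\ [set nb v; v] \in edges (G i).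
  rewrite inE => vA; rewrite /nb; case: pickP => [u /andP[] //|no].
  have [u /activesP uA] := dom v; rewrite inE => /orP[/eqP vu|uv].
    by rewrite vu uA in vA.
  by have := no u; rewrite uA uv.
rewrite -(@card_in_imset _ _ (fun v => [set nb v; v])).
  by apply/subset_leq_card/subsetP => e /imsetP[v /nbP[_ ?] ->].
move=> v w vA wA /setP/(_ v); rewrite !inE eqxx orbT => /esym/orP[]/eqP //.
have [wN _] := nbP w wA.
by move=> vw; move: vA; rewrite inE vw wN.
Qed.

Lemma dominating_timeline_bound G k l : 0 < #|V| ->
  has_dominating_timeline G k l ->
  #|V| * (T - k * l.+1) <= \sum_i minn #|V|.-1 #|edges (G i)|.
Proof.
move=> V_gt0 [S tS dom].
(* The edge bound is [inactives_le]; the cap [#|V|.-1] holds because dominating any vertex at time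
   [i] already takes one active vertex. *)
have ge_i i : #|V| <= #|actives S i| + minn #|V|.-1 #|edges (G i)|.
  have := inactives_le (fun v => dom v i); have := cardsC (actives S i).
  have [v _] := card_gt0P V_gt0.
  have [u /activesP uA _] := dom v i.
  have : 0 < #|actives S i| by apply/card_gt0P; exists u.
  lia.
have : \sum_(i < T) #|V| <=
    \sum_i (#|actives S i| + minn #|V|.-1 #|edges (G i)|) by apply: leq_sum => i _.
rewrite sum_nat_const card_ord big_split /=.
(* Multiplication distributes over truncated subtraction, so [T < k * l.+1] needs no separate
   case. *)
rewrite mulnBr leq_subLR [T * _]mulnC => /leq_trans; apply.
by rewrite leq_add2r; apply: sum_actives_le.
Qed.

(** The times are cut into blocks of [l.+1] consecutive ones, the last block ending at [T.-1]; there
    are at most [k] blocks, and every vertex receives all of them as intervals. *)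
Lemma dominating_timeline_full G k l : T <= k * l.+1 ->
  has_dominating_timeline G k l.
Proof.
move=> Tk.
exists [set p : interval V T |
         (l.+1 %| istart p) && (nat_of_ord (iend p) == minn (istart p + l) T.-1)].
  split=> [p|v].
    by rewrite inE => /andP[_ /eqP ->]; have := ltn_ord (istart p); lia.
  set A := [set p in _ | _].
  have lt_k (p : interval V T) : istart p %/ l.+1 < k.
    by rewrite ltn_divLR //; apply: leq_trans (ltn_ord _) Tk.
  (* The block index maps the intervals of [v] injectively into ['I_k]: it determines the start,
     which determines the end. *)
  rewrite -[leqRHS]card_ord -(@card_in_imset _ _ (fun p => Ordinal (lt_k p))).
    exact: max_card.
  move=> [[u a] b] [[u' a'] b']; rewrite !inE /=.
  rewrite /ivertex /istart /iend /=.
  move=> /andP[/andP[la /eqP eb] /eqP ->] /andP[/andP[la' /eqP eb'] /eqP ->].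
  move=> /(congr1 val) /= eq_q.
  have eq_a : a = a' by apply: val_inj; rewrite /= -(divnK la) -(divnK la') eq_q.
  by subst a'; congr (_, _); apply: val_inj; rewrite /= eb eb'.
move=> v i; exists v; last by rewrite inE eqxx.
have lt_a : i %/ l.+1 * l.+1 < T by apply: leq_ltn_trans (ltn_ord i); lia.
have lt_b : minn (i %/ l.+1 * l.+1 + l) T.-1 < T by have := ltn_ord i; lia.
exists (v, Ordinal lt_a, Ordinal lt_b).
  by rewrite inE /istart /iend /= dvdn_mull //=.
split=> //; rewrite /istart /iend /=.
by have := ltn_ord i; have := divn_eq i l.+1; have := ltn_pmod i (ltn0Sn l); lia.
Qed.

End Counting.

(** * Arithmetic of the cubic bound *)

Lemma kernel_size_bound n T k l q : 0 < k ->
  0 < n * (T - k * l.+1) -> n * (T - k * l.+1) <= n.-1 * T ->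
  n * (T - k * l.+1) <= q * T ->
  T <= 2 * (q + k + l) ^ 3 /\ n <= 2 * (q + k + l) ^ 3.
Proof.
move=> k_gt0; set c := k * l.+1; set p := q + k + l.
rewrite muln_gt0 => /andP[n_gt0 d_gt0] le1 le2.
(* Since [k] is positive, [l.+1 <= p]. *)
have cp : c <= p * p by rewrite leq_mul // /p; lia.
have p_gt0 : 0 < p by rewrite /p; lia.
have qp : q <= p by rewrite /p; lia.
have p3 : p ^ 3 = p * (p * p) by rewrite !expnS expn0 muln1.
have pp3 : p * p <= p ^ 3 by rewrite p3 leq_pmull.
have p_p3 : p <= p ^ 3 by apply: leq_trans pp3; rewrite leq_pmulr.
have qc : q * c <= p ^ 3 by rewrite p3 leq_mul.
have [nq|qn] := leqP n (2 * q).
  split; last lia.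
  (* Rearranging [n * (T - c) <= n.-1 * T]. *)
  have : T <= n * c by nia.
  have : n * c <= 2 * q * c by rewrite leq_mul.
  rewrite -mulnA; lia.
(* Otherwise [T < 2 * (T - c)], and then [q * T <= 2 * q * (T - c) < n * (T - c)], against [le2]. *)
have Tc : T <= 2 * c by nia.
split; first lia.
have : n <= n * (T - c) by rewrite leq_pmulr.
have : q * T <= q * (2 * c) by rewrite leq_mul.
nia.
Qed.

(** * Running programs *)

(** A total-correctness triple with a time budget; [n] is only an upper bound, so budgets can be
    rounded up. *)
Definition runs (B : nat) (P : prog) (s : state) (n : nat) (Q : state -> Prop) :=
  exists t s', [/\ exec B P s t s', t <= n & Q s'].

Section Runs.
Variable B : nat.
Implicit Types (P : prog) (s : state) (Q : state -> Prop).

Lemma runs_weaken P s m n Q Q' :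
  runs B P s m Q -> m <= n -> (forall s', Q s' -> Q' s') -> runs B P s n Q'.
Proof.
by move=> [t [s' [ex le_t Qs']]] le_mn QQ'; exists t, s'; split=> //; [lia|exact: QQ'].
Qed.

Lemma runs_instr c s s' Q : exec_instr B c s = Some s' -> Q s' ->
  runs B (Instr c) s 1 Q.
Proof. by move=> ex Qs'; exists 1, s'; split=> //; apply: ExecInstr. Qed.

(** The run of [P2] is itself the postcondition of [P1], which lets a program be executed
    symbolically from left to right. *)
Lemma runs_seq P1 P2 s m n Q :
  runs B P1 s m (fun s' => runs B P2 s' n Q) -> runs B (Seq P1 P2) s (m + n) Q.
Proof.
move=> [t1 [s1 [ex1 le1 [t2 [s2 [ex2 le2 Qs2]]]]]].
by exists (t1 + t2), s2; split=> //; [apply: ExecSeq ex1 ex2|lia].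
Qed.

Lemma runs_cons c P s s' n Q : exec_instr B c s = Some s' ->
  runs B P s' n Q -> runs B (Seq (Instr c) P) s n.+1 Q.
Proof. by move=> ex run; rewrite -add1n; apply/runs_seq/(runs_instr ex). Qed.

Lemma runs_if x P1 P2 s n Q :
  (regs s x != 0 -> runs B P1 s n Q) -> (regs s x = 0 -> runs B P2 s n Q) ->
  runs B (If x P1 P2) s n.+1 Q.
Proof.
have [x0 _ /(_ x0)|x0 /(_ isT) + _] := eqVneq (regs s x) 0 => -[t [s' [ex le Qs']]];
  exists t.+1, s'; split=> //.
  exact: ExecIfFalse.
exact: ExecIfTrue.
Qed.

Lemma runs_while_end x P s n Q : regs s x = 0 -> Q s ->
  runs B (While x P) s n.+1 Q.
Proof. by move=> x0 Qs; exists 1, s; split=> //; apply: ExecWhileEnd. Qed.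

Lemma runs_while_step x P s m n Q : regs s x != 0 ->
  runs B P s m (fun s' => runs B (While x P) s' n Q) ->
  runs B (While x P) s (m + n).+1 Q.
Proof.
move=> x0 [t1 [s1 [ex1 le1 [t2 [s2 [ex2 le2 Qs2]]]]]].
exists (t1 + t2).+1, s2; split=> //; last lia.
exact: ExecWhileStep ex1 ex2.
Qed.

End Runs.

(** * The kernelization program *)

(** [rZero] keeps its initial value. [rN1] holds n - 1, [rI] the snapshots left, [rP] the next free
    address and later the words left to write, [rS] the sum s, [rE] an edge count, [rJ] a loop
    counter, [rV] the current word and later its address; [rM] is scratch. *)
Local Notation rZero := 0.
Local Notation rOne := 1.
Local Notation rN := 2.
Local Notation rT := 3.
Local Notation rK := 4.
Local Notation rL := 5.
Local Notation rN1 := 6.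
Local Notation rI := 7.
Local Notation rP := 8.
Local Notation rS := 9.
Local Notation rE := 10.
Local Notation rJ := 11.
Local Notation rV := 12.
Local Notation rM := 13.
Local Notation rD := 14.

Local Notation "c ;; P" := (Seq (Instr c) P) (at level 60, right associativity).

(** The input can be read only once, so it is copied to memory in case it has to be output again. *)
Definition read_words : prog :=
  While rJ (Input rV ;; Store rP rV ;; Add rP rP rOne ;; Instr (Sub rJ rJ rOne)).

(* Truncated subtraction gives minimum as a - (a - b). *)
Definition read_snapshots : prog :=
  While rI
    (Input rE ;; Store rP rE ;; Add rP rP rOne ;;
     Sub rM rE rN1 ;; Sub rM rE rM ;; Add rS rS rM ;; Add rJ rE rE ;;
     Seq read_words (Instr (Sub rI rI rOne))).

(** A product such as n d can exceed the largest word, which is only linear; repeated truncated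
    subtraction avoids forming it. *)
Definition sub_times (x y : nat) : prog :=
  While rJ (Sub x x y ;; Instr (Sub rJ rJ rOne)).

Definition write_words : prog :=
  While rP (Fetch rM rV ;; Output rM ;; Add rV rV rOne ;; Instr (Sub rP rP rOne)).

Definition write_instance : prog :=
  Output rN ;; Output rT ;; Output rK ;; Output rL ;; Sub rV rV rV ;; write_words.

Definition write_yes : prog :=
  Output rZero ;; Output rZero ;; Output rOne ;; Instr (Output rZero).

(** The instance with one vertex, two edgeless snapshots, k = 1 and l = 0: a single activity of one
    time step cannot cover both times. *)
Definition write_no : prog :=
  Add rM rOne rOne ;; Output rOne ;; Output rM ;; Output rOne ;;
  Output rZero ;; Output rZero ;; Instr (Output rZero).

(* The register rD receives d = T - k (l + 1), computed with min(k, T)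
   truncated subtractions; afterwards rM receives s + 1 - n d, which is nonzero
   exactly when n d <= s. *)
Definition decide : prog :=
  Add rD rT rZero ;; Sub rM rK rT ;; Sub rJ rK rM ;; Add rM rL rOne ;;
  Seq (sub_times rD rM)
    (Add rM rS rOne ;; Add rJ rN rZero ;;
     Seq (sub_times rM rD)
       (If rM (If rD (If rN write_instance write_yes) write_yes) write_no)).

Definition kernelize : prog :=
  Const rOne 1 ;; Input rN ;; Input rT ;; Input rK ;; Input rL ;;
  Sub rN1 rN rOne ;; Add rI rT rZero ;;
  Seq read_snapshots decide.

(** * Specifications of the loops *)

Definition frame (X : seq nat) (s s' : state) :=
  forall x, x \notin X -> regs s' x = regs s x.

Definition stored (s : state) (u : seq nat) :=
  regs s rP = size u /\ forall i, i < size u -> mem s i = nth 0 u i.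

(** Endpoints are plain numbers, so that the program is verified without reference to instances and
    their dependent types. *)
Definition snapshot_words (b : seq (nat * nat)) : seq nat :=
  size b :: flatten [seq [:: p.1; p.2] | p <- b].

Lemma size_flatten_pairs (b : seq (nat * nat)) :
  size (flatten [seq [:: p.1; p.2] | p <- b]) = size b + size b.
Proof. by elim: b => //= p b ->; lia. Qed.

Section Correctness.
Variable B : nat.

(** Induction on the words still to be read, [acc] being those already stored. A round costs one
    test and four instructions. *)
Lemma read_words_correct u rest acc s :
  regs s rOne = 1 -> regs s rJ = size u -> inp s = u ++ rest ->
  stored s acc -> all (leq^~ B) u -> size acc + size u <= B ->
  runs B read_words s (5 * size u).+1 (fun s' =>
    [/\ stored s' (acc ++ u), inp s' = rest, out s' = out s
      & frame [:: rJ; rP; rV] s s']).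
Proof.
elim: u acc s => [|v u IH] acc s one cnt inps [ptr stk] /=.
  by move=> _ _; apply: runs_while_end => //; rewrite cats0.
move=> /andP[vB uB] szB.
apply: (@runs_weaken _ _ _ (4 + (5 * size u).+1).+1); last 2 first.
- lia.
- by move=> s'; apply.
apply: runs_while_step; first by rewrite cnt.
apply: runs_cons; first by rewrite /= inps /= vB.
apply: runs_cons => //=.
apply: runs_cons; first by rewrite /= /upd /= ptr one ifT //; move: szB => /=; lia.
apply: runs_instr => //.
set s1 := set_reg _ _ _.
have st1 : stored s1 (rcons acc v).
  rewrite /stored /s1 /= /upd /= size_rcons addn1; split=> // i.
  rewrite ltnS nth_rcons ?ptr => le_i.
  by have [->|ne] := eqVneq i (size acc); [rewrite ltnn|rewrite ifT ?stk //; lia].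
have := IH (rcons acc v) s1 _ _ _ st1 uB.
rewrite {1 2 3}/s1 /= /upd /= cnt one subn1 => /(_ erefl erefl erefl).
rewrite size_rcons => IH1.
apply: runs_weaken (IH1 _) (leqnn _) _; first lia.
move=> s' [st' inp' out' fr']; split=> //; first by rewrite -cat_rcons.
move=> x xX; rewrite fr' // /s1 /= /upd; move: xX; rewrite !inE !negb_or.
by move=> /and3P[/negPf-> /negPf-> /negPf->].
Qed.

(** The factor 2 in the bound on [rS] leaves room for the doubled edge count put into [rJ]; the sum
    itself grows by at most one per edge. *)
Lemma read_snapshots_correct bs rest acc s :
  regs s rOne = 1 -> regs s rI = size bs ->
  inp s = flatten [seq snapshot_words b | b <- bs] ++ rest ->
  stored s acc ->
  all (leq^~ B) (flatten [seq snapshot_words b | b <- bs]) ->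
  size acc + size (flatten [seq snapshot_words b | b <- bs]) <= B ->
  regs s rS + 2 * size (flatten bs) <= B ->
  runs B read_snapshots s (20 * size bs + 10 * size (flatten bs)).+1 (fun s' =>
    [/\ stored s' (acc ++ flatten [seq snapshot_words b | b <- bs]),
        regs s' rS = regs s rS + \sum_(b <- bs) minn (regs s rN1) (size b),
        inp s' = rest, out s' = out s
      & frame [:: rI; rP; rS; rE; rJ; rV; rM] s s']).
Proof.
elim: bs acc s => [|b bs IH] acc s one cnt inps [ptr stk].
  by move=> _ _ _; apply: runs_while_end => //; rewrite big_nil cats0 addn0.
set u := flatten [seq [:: p.1; p.2] | p <- b].
set body := flatten [seq snapshot_words b | b <- bs].
have szu : size u = size b + size b by apply: size_flatten_pairs.
have eqf : flatten [seq snapshot_words b | b <- b :: bs] = size b :: u ++ body.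
  by [].
rewrite eqf in inps *; rewrite /= size_cat all_cat size_cat.
move=> /andP[bB /andP[uB bodyB]] szB SB.
(* One test, seven instructions, the word loop and the final decrement, followed by the remaining
   snapshots. *)
apply: (@runs_weaken _ _ _
  (((5 * size u).+1 + 1).+4.+3 + (20 * size bs + 10 * size (flatten bs)).+1).+1);
  last 2 first.
- by rewrite szu; lia.
- by move=> s'; apply.
apply: runs_while_step; first by rewrite cnt.
apply: runs_cons; first by rewrite /= inps /= bB.
apply: runs_cons => //=.
apply: runs_cons; first by rewrite /= /upd /= ptr one ifT //; lia.
apply: runs_cons => //=.
apply: runs_cons => //=.
apply: runs_cons; first by rewrite /= /upd /= ifT //; lia.
apply: runs_cons; first by rewrite /= /upd /= ifT //; lia.
set s1 := set_reg _ _ _.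
have st1 : stored s1 (rcons acc (size b)).
  rewrite /stored /s1 /= /upd /= size_rcons addn1; split=> // i.
  rewrite ltnS nth_rcons ?ptr => le_i.
  by have [->|ne] := eqVneq i (size acc); [rewrite ltnn|rewrite ifT ?stk //; lia].
apply: runs_seq.
apply: runs_weaken (@read_words_correct u (body ++ rest) _ s1 _ _ _ st1 uB _) _ _ => //.
- by rewrite /s1 /= catA.
- by rewrite size_rcons; lia.
move=> s2 [st2 inp2 out2 fr2].
apply: runs_instr => //.
set s3 := set_reg _ _ _.
have st3 : stored s3 (rcons acc (size b) ++ u) by [].
have S3 : regs s3 rS = regs s rS + minn (regs s rN1) (size b).
  by rewrite /s3 /= /upd /= fr2 // /s1 /= /upd /=; lia.
have fr3 : frame [:: rI; rP; rS; rE; rJ; rV; rM] s s3.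
  move=> x; rewrite !inE !negb_or => /and4P[/negPf x1 /negPf x2 /negPf x3].
  move=> /and4P[/negPf x4 /negPf x5 /negPf x6 /negPf x7].
  rewrite /s3 /= /upd x1 fr2 ?inE ?x2 ?x5 ?x6 //.
  by rewrite /s1 /= /upd x5 x3 x7 x2 x4.
have I3 : regs s3 rI = size bs.
  by rewrite /s3 /= /upd /= !fr2 // /s1 /= /upd /= cnt one /= subn1.
apply: runs_weaken (IH _ s3 _ I3 inp2 st3 bodyB _ _) (leqnn _) _.
- by rewrite fr3.
- by rewrite size_cat size_rcons -/body; lia.
- by rewrite S3; lia.
move=> s' [st' S' inp' out' fr']; split=> //.
- by move: st'; rewrite -cats1 -!catA.
- by rewrite S' S3 big_cons fr3 // addnA.
- by rewrite out' -out2.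
- by move=> x xX; rewrite fr' // fr3.
Qed.

(** Truncation is harmless, as [a - y - j * y = a - j.+1 * y] always holds. Distinctness of the
    registers keeps [y] and the constant one intact. *)
Lemma sub_times_correct x y j s :
  regs s rOne = 1 -> regs s rJ = j -> uniq [:: x; y; rJ; rOne] ->
  runs B (sub_times x y) s (3 * j).+1 (fun s' =>
    [/\ regs s' x = regs s x - j * regs s y, mem s' = mem s, out s' = out s
      & frame [:: x; rJ] s s']).
Proof.
rewrite /= !inE !negb_or => + + /and3P[/and3P[xy xJ xO] /andP[yJ yO] _].
elim: j s => [|j IH] s one cnt.
  by apply: runs_while_end => //; rewrite subn0.
rewrite (_ : (3 * j.+1).+1 = (2 + (3 * j).+1).+1); last lia.
apply: runs_while_step; first by rewrite cnt.
apply: runs_cons => //=.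
apply: runs_instr => //.
set s1 := set_reg _ _ _.
have s1x : regs s1 x = regs s x - regs s y by rewrite /s1 /= /upd eqxx (negPf xJ).
have s1y : regs s1 y = regs s y.
  by rewrite /s1 /= /upd (negPf yJ) eq_sym (negPf xy).
apply: runs_weaken (IH s1 _ _) (leqnn _) _.
- by rewrite /s1 /= /upd /= [1 == x]eq_sym (negPf xO).
- by rewrite /s1 /= /upd /= ![_ == x]eq_sym (negPf xJ) (negPf xO) cnt one subn1.
move=> s' [x' mem' out' fr']; split=> //.
  by rewrite x' s1x s1y mulSn subnDA.
move=> z zX; rewrite fr' // /s1 /= /upd; move: zX; rewrite !inE negb_or.
by move=> /andP[/negPf-> /negPf->].
Qed.

(** Induction on the words [v] still to be written; [u] is the part of memory already passed. *)
Lemma write_words_correct u v s :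
  regs s rOne = 1 -> regs s rP = size v -> regs s rV = size u ->
  (forall i, i < size (u ++ v) -> mem s i = nth 0 (u ++ v) i) ->
  size (u ++ v) <= B ->
  runs B write_words s (5 * size v).+1 (fun s' => out s' = out s ++ v).
Proof.
elim: v u s => [|a v IH] u s one cnt pos stk szB.
  by apply: runs_while_end => //; rewrite cats0.
have szuv : size (u ++ a :: v) = (size u + size v).+1 by rewrite size_cat addnS.
rewrite (_ : (5 * size (a :: v)).+1 = (4 + (5 * size v).+1).+1); last by rewrite /=; lia.
apply: runs_while_step; first by rewrite cnt.
apply: runs_cons => //=.
apply: runs_cons => //=.
apply: runs_cons; first by rewrite /= /upd /= pos one ifT //; lia.
apply: runs_instr => //.
set s1 := set_reg _ _ _.
apply: runs_weaken (IH (rcons u a) s1 _ _ _ _ _) (leqnn _) _.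
- by rewrite /s1 /= /upd.
- by rewrite /s1 /= /upd /= cnt one subn1.
- by rewrite /s1 /= /upd /= size_rcons addn1.
- by rewrite cat_rcons.
- by rewrite cat_rcons.
move=> s' ->; rewrite /s1 /= /upd /= ?pos stk ?szuv; last lia.
by rewrite nth_cat ltnn subnn -cats1 -catA.
Qed.

(** * The decision and the whole program *)

Definition yes_words : seq nat := [:: 0; 0; 1; 0].
Definition no_words : seq nat := [:: 1; 2; 1; 0; 0; 0].

Definition kernel_words (n T k l : nat) (bs : seq (seq (nat * nat))) : seq nat :=
  let d := T - k * l.+1 in
  if n * d == 0 then yes_words
  else if n * d <= \sum_(b <- bs) minn n.-1 (size b) then
    [:: n; T; k; l] ++ flatten [seq snapshot_words b | b <- bs]
  else no_words.

Lemma decide_correct n T k l bs s :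
  regs s rZero = 0 -> regs s rOne = 1 -> regs s rN = n -> regs s rT = T ->
  regs s rK = k -> regs s rL = l ->
  regs s rS = \sum_(b <- bs) minn n.-1 (size b) ->
  stored s (flatten [seq snapshot_words b | b <- bs]) -> out s = [::] ->
  size bs = T ->
  n + 2 * T + l + 2 * size (flatten bs) + 2 <= B ->
  runs B decide s (50 + 3 * T + 3 * n + 5 * (T + 2 * size (flatten bs)))
    (fun s' => out s' = kernel_words n T k l bs).
Proof.
move=> r0 r1 rn rt rk rl rs [ptr stk] out0 szbs szB.
set body := flatten [seq snapshot_words b | b <- bs] in ptr stk *.
have szbody : size body = T + 2 * size (flatten bs).
  rewrite -szbs /body; elim: (bs) => //= b bs' IH.
  by rewrite !size_cat size_flatten_pairs IH; lia.
have leS : \sum_(b <- bs) minn n.-1 (size b) <= size (flatten bs).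
  rewrite size_flatten sumnE big_map; apply: leq_sum => b _; exact: geq_minr.
set S := \sum_(b <- bs) _ in rs leS.
apply: (@runs_weaken _ _ _
  ((3 * minn k T).+1 + ((3 * n).+1 + (20 + 5 * size body).+3).+2).+4); last 2 first.
- rewrite szbody; lia.
- by move=> s'; apply.
apply: runs_cons; first by rewrite /= r0 rt addn0 ifT //; lia.
apply: runs_cons => //=.
apply: runs_cons => //=.
apply: runs_cons; first by rewrite /= /upd /= rl r1 ifT //; lia.
set s1 := set_reg _ _ _.
apply: runs_seq.
apply: runs_weaken (@sub_times_correct rD rM (minn k T) s1 _ _ _) (leqnn _) _ => //.
- by rewrite /s1 /= /upd /= rk rt; lia.
move=> s2 [D2 mem2 out2 fr2].
have {}D2 : regs s2 rD = T - k * l.+1.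
  rewrite D2 /s1 /= /upd /= ?rl ?r1 addn1.
  (* If [k > T], then [T] subtractions of [l.+1 >= 1] already reach 0, the value of [T - k * l.+1];
     the cap keeps the running time independent of [k]. *)
  by have [kT|Tk] := leqP k T => //; nia.
apply: runs_cons; first by rewrite /= !fr2 // /s1 /= /upd /= rs r1 ifT //; lia.
apply: runs_cons.
  by rewrite /= /upd /= !fr2 // /s1 /= /upd /= rn r0 addn0 ifT //; lia.
set s3 := set_reg _ _ _.
have fr3 : frame [:: rD; rJ; rM] s s3.
  move=> x; rewrite !inE !negb_or => /and3P[/negPf x1 /negPf x2 /negPf x3].
  rewrite /s3 /= /upd x2 x3 fr2 ?inE ?x1 ?x2 //.
  by rewrite /s1 /= /upd x1 x2 x3.
apply: runs_seq.
apply: runs_weaken (@sub_times_correct rM rD n s3 _ _ _) (leqnn _) _ => //.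
- by rewrite fr3.
move=> s4 [M4 mem4 out4 fr4].
have fr4' : frame [:: rD; rJ; rM] s s4.
  move=> x xX; rewrite fr4 ?fr3 //.
  by move: xX; rewrite !inE !negb_or => /and3P[_ -> ->].
have D4 : regs s4 rD = T - k * l.+1 by rewrite fr4.
have {}M4 : regs s4 rM = S.+1 - n * (T - k * l.+1).
  by rewrite M4 /s3 /= /upd /= D2 addn1.
have {}out4 : out s4 = [::] by rewrite out4 /s3 /= out2 /s1 /= out0.
have {}mem4 : mem s4 = mem s by rewrite mem4 /s3 /= mem2.
have yes_run m : runs B write_yes s4 (4 + m) (fun s' => out s' = yes_words).
  apply: (@runs_weaken _ _ _ 4); last 2 first.
  - lia.
  - by move=> s'; apply.
  do 3 apply: runs_cons => //=.
  by apply: runs_instr => //=; rewrite out4 !fr4' //= r0 r1.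
rewrite /kernel_words -/S -/body; set d := T - _ in D4 M4 *.
apply: runs_if => M0.
  apply: runs_if => D0.
    apply: runs_if => N0.
      rewrite fr4' // rn in N0; rewrite D4 in D0.
      have /negPf-> : n * d != 0 by rewrite muln_eq0 negb_or N0 D0.
      rewrite ifT; last by lia.
      apply: (@runs_weaken _ _ _ (5 * size body).+1.+4.+1); last 2 first.
      - lia.
      - by move=> s'; apply.
      do 5 apply: runs_cons => //=.
      set s5 := set_reg _ _ _.
      apply: runs_weaken (@write_words_correct [::] body s5 _ _ _ _ _) (leqnn _) _.
      - by rewrite /s5 /= /upd /= fr4'.
      - by rewrite /s5 /= /upd /= fr4'.
      - by rewrite /s5 /= /upd /= subnn.
      - by move=> i lt_i; rewrite /s5 /= mem4 stk.
      - by rewrite /= szbody; lia.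
      by move=> s' ->; rewrite /s5 /= out4 !fr4' //= rn rt rk rl.
    rewrite fr4' // rn in N0; rewrite N0 mul0n eqxx.
    by apply: runs_weaken (yes_run (14 + 5 * size body)) _ _ => //; lia.
  rewrite -D4 D0 muln0 eqxx.
  by apply: runs_weaken (yes_run (14 + 5 * size body)) _ _ => //; lia.
(* A zero in [rM] means [S < n * d], so [n * d] is nonzero and both conditions of [kernel_words]
   fail. *)
rewrite ifF; last by lia.
rewrite ifF; last by lia.
apply: (@runs_weaken _ _ _ 7); last 2 first.
- lia.
- by move=> s'; apply.
apply: runs_cons; first by rewrite /= !fr4' //= r1 ifT //; lia.
do 5 apply: runs_cons => //=.
by apply: runs_instr => //=; rewrite /upd /= out4 !fr4' //= r0 r1.
Qed.

(** The numbers [k] and [l] enter the word bound but not the time bound. That endpoints are below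
    [n] ensures that all input words fit. *)
Lemma kernelize_correct n T k l bs w :
  w = [:: n; T; k; l] ++ flatten [seq snapshot_words b | b <- bs] ->
  size bs = T -> all (all (fun p => (p.1 < n) && (p.2 < n))) bs ->
  2 * (n + T + size (flatten bs) + k + l + 1) <= B ->
  exists2 t, computes B kernelize w t (kernel_words n T k l bs)
           & t <= 100 * (n + T + size (flatten bs) + 1).
Proof.
move=> def_w szbs lt_n szB.
set body := flatten [seq snapshot_words b | b <- bs] in def_w.
have [szbody bodyB] : size body = T + 2 * size (flatten bs) /\ all (leq^~ B) body.
  have : size (flatten bs) <= B by lia.
  rewrite -szbs /body; move: lt_n; elim: (bs) => //= b bs' IH /andP[bn bsn].
  rewrite size_cat => leB; have [|IH1 IH2] := IH bsn; first lia.
  rewrite !size_cat size_flatten_pairs IH1 all_cat IH2 andbT; split; first lia.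
  apply/andP; split; first lia.
  by elim: (b) bn => //= p b' IHb /andP[/andP[p1 p2] /IHb ->]; rewrite andbT; lia.
suff [t [s' [ex le_t out_s']]] : runs B kernelize (init_state w)
    (100 * (n + T + size (flatten bs) + 1)) (fun s' => out s' = kernel_words n T k l bs).
  by exists t => //; exists s'.
apply: (@runs_weaken _ _ _
  ((20 * size bs + 10 * size (flatten bs)).+1 +
   (50 + 3 * T + 3 * n + 5 * (T + 2 * size (flatten bs)))).+4.+3); last 2 first.
- lia.
- by move=> s'; apply.
apply: runs_cons; first by rewrite /= ifT //; lia.
apply: runs_cons; first by rewrite /= def_w /= ifT //; lia.
apply: runs_cons; first by rewrite /= ifT //; lia.
apply: runs_cons; first by rewrite /= ifT //; lia.
apply: runs_cons; first by rewrite /= ifT //; lia.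
apply: runs_cons => //=.
apply: runs_cons; first by rewrite /= /upd /= addn0 ifT //; lia.
set s1 := set_reg _ _ _.
apply: runs_seq.
apply: runs_weaken (@read_snapshots_correct bs [::] [::] s1 _ _ _ _ bodyB _ _) (leqnn _) _ => //.
- by rewrite /s1 /= cats0.
- by rewrite add0n -/body szbody; lia.
- by rewrite /s1 /= /upd /=; lia.
move=> s2 [st2 S2 inp2 out2 fr2].
apply: decide_correct => //; try by rewrite fr2.
- by rewrite S2 /s1 /= /upd /= subn1.
- lia.
Qed.

End Correctness.

(** * Trivial instances *)

Lemma edgeless_card2 (V : finType) (e : {set V}) :
  e \in (set0 : {set {set V}}) -> #|e| = 2.
Proof. by rewrite inE. Qed.

Definition edgeless (V : finType) : sgraph V := SGraph (@edgeless_card2 V).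

Definition edgeless_instance (n T : nat) : tds_instance :=
  @TDSInstance n T (fun=> edgeless _) 1 0 (ltn0Sn 0).

Lemma edgeless_instance_encodes n T :
  encodes (edgeless_instance n T) ([:: n; T; 1; 0] ++ nseq T 0).
Proof.
exists (fun=> [::]) => [i|] /=; first by rewrite enum_set0.
do 4 congr (_ :: _).
suff flat (r : seq 'I_T) : flatten [seq [:: 0] | _ <- r] = nseq (size r) 0.
  by rewrite flat size_enum_ord.
by elim: r => //= _ r ->.
Qed.

Lemma max_edges_edgeless n T : max_edges (edgeless_instance n T) = 0.
Proof. by apply: big1 => i _; rewrite cards0. Qed.

Lemma edgeless_instance_yes : yes_instance (edgeless_instance 0 0).
Proof. exact: dominating_timeline_full. Qed.

(** The counting bound would read [1 * (2 - 1) <= 0]. *)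
Lemma edgeless_instance_no : ~ yes_instance (edgeless_instance 1 2).
Proof.
move=> /dominating_timeline_bound; rewrite card_ord => /(_ isT) /=.
by rewrite big1 // => i _; rewrite min0n.
Qed.

Lemma yes_instance_full (I : tds_instance) :
  nverts I * (nsnaps I - act I * (len I).+1) = 0 -> yes_instance I.
Proof.
move=> /eqP; rewrite muln_eq0 => /orP[/eqP n0|T0].
  exists set0 => [|v i]; last by have := ltn_ord v; rewrite {2}n0.
  by split=> [p|v]; rewrite ?inE // setIdE set0I cards0.
by apply: dominating_timeline_full; rewrite -subn_eq0.
Qed.

(** * Assembling the kernel *)

Theorem theorem4p6 :
  exists (P : prog) (C : nat) (g : nat -> nat),
    forall (I : tds_instance) (w : seq nat), encodes I w ->
    exists (t : nat) (w' : seq nat) (J : tds_instance),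
      [/\ computes (word_bound C I) P w t w' /\ t <= C * (input_size I + 1),
          encodes J w',
          yes_instance I <-> yes_instance J,
          nsnaps J <= C * parameter I ^ 3 /\ nverts J <= C * parameter I ^ 3
        & parameter J <= g (parameter I)].
Proof.
(* A copied instance keeps its parameter and the constant ones have parameter 1, so [succn] bounds
   all three outcomes. *)
exists kernelize, 100, succn => I w encI.
have [L permL def_w] := encI.
set n := nverts I in L permL def_w *; set T := nsnaps I in L permL def_w *.
have k_gt0 := act_gt0 I.
(* Positivity lets the cubic bound cover the constant no-instance. *)
have p3_gt0 : 0 < parameter I ^ 3 by rewrite expn_gt0 /parameter; lia.
have sizeL i : size (L i) = #|edges (tg i)|.
  by rewrite cardE -(perm_size (permL i)) size_map.
pose word (p : 'I_n * 'I_n) := (nat_of_ord p.1, nat_of_ord p.2).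
pose bs := [seq map word (L i) | i <- enum 'I_T].
have size_bs : size bs = T by rewrite size_map size_enum_ord.
have size_flat : size (flatten bs) = \sum_i #|edges (@tg I i)|.
  rewrite size_flatten sumnE 2!big_map big_enum /=.
  by apply: eq_bigr => i _; rewrite size_map sizeL.
have sum_bs : \sum_(b <- bs) minn n.-1 (size b)
            = \sum_i minn n.-1 #|edges (@tg I i)|.
  rewrite big_map big_enum /=.
  by apply: eq_bigr => i _; rewrite size_map sizeL.
have {}def_w : w = [:: n; T; act I; len I] ++ flatten [seq snapshot_words b | b <- bs].
  rewrite def_w; congr (_ ++ flatten _); rewrite /bs -[RHS]map_comp.
  by apply: eq_map => i /=; rewrite /snapshot_words size_map -map_comp.
have lt_n : all (all (fun p => (p.1 < n) && (p.2 < n))) bs.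
  by apply/allP => b /mapP[i _ ->]; apply/allP => p /mapP[q _ ->] /=; rewrite !ltn_ord.
have [|t comp_t le_t] :=
    @kernelize_correct (word_bound 100 I) _ _ _ _ _ _ def_w size_bs lt_n.
  by rewrite size_flat; apply: leq_mul.
exists t, (kernel_words n T (act I) (len I) bs).
have {}le_t : t <= 100 * (input_size I + 1).
  by rewrite /input_size -/n -/T -size_flat.
move: comp_t; rewrite /kernel_words sum_bs.
have [nd0|nd0] := eqVneq (n * (T - act I * (len I).+1)) 0 => [comp_t|].
  exists (edgeless_instance 0 0); split=> //; first exact: edgeless_instance_encodes.
  - by split=> _; [apply: edgeless_instance_yes|apply: yes_instance_full].
  - by rewrite /parameter max_edges_edgeless /=; lia.
case: leqP => le_s comp_t.
  (* The output repeats the given encoding [w] verbatim, in its own order of edges and endpoints, so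
     it encodes [I] again. *)
  exists I; split=> //; first by rewrite -def_w.
  have leq_s : n * (T - act I * (len I).+1) <= max_edges I * T.
    apply: leq_trans le_s _; rewrite mulnC -[in leqRHS](card_ord T) -sum_nat_const.
    apply: leq_sum => i _; apply: leq_trans (geq_minr _ _) _.
    exact: (leq_bigmax (F := fun i => #|edges (@tg I i)|)).
  have len_s : n * (T - act I * (len I).+1) <= n.-1 * T.
    apply: leq_trans le_s _; rewrite mulnC -[in leqRHS](card_ord T) -sum_nat_const.
    by apply: leq_sum => i _; apply: geq_minl.
  have [|le_T le_n] := kernel_size_bound k_gt0 _ len_s leq_s; first by rewrite lt0n.
  by split; [apply: leq_trans le_T _|apply: leq_trans le_n _]; rewrite leq_mul2r orbT.
exists (edgeless_instance 1 2); split=> //; first exact: edgeless_instance_encodes.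
- split=> [yesI|/edgeless_instance_no //].
  move: le_s; rewrite ltnNge => /negP[].
  have := dominating_timeline_bound _ yesI.
  rewrite card_ord -/n -/T; apply.
  by move: nd0; rewrite muln_eq0 negb_or lt0n => /andP[].
- by rewrite /=; lia.
- by rewrite /parameter max_edges_edgeless /=; lia.
Qed.
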